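(* Consider a sequential decision-making problem with unit query costs in which the contexts $u_1,u_2,\dots$ are drawn i.i.d. from a distribution $\mathcal P_u$. Let $\mathbb A$ be an anytime algorithm for the corresponding unbudgeted problem such that, for some $\alpha,C\ge 0$ and $\beta\in[0,1]$, its expected regret satisfies $\mathbb E[\mathrm{Reg}(T)]\le \alpha T^{\beta}+C$ for every $T\in\mathbb N$. Let $\{B(t)\}_{t\ge1}$ be a budget sequence chosen by an oblivious adversary (i.e. fixed before the interaction starts) that is non-decreasing with $B(1)\ge 1$ and $B(t)\in\mathbb N$ for all $t\ge1$. Then for every $T\in\mathbb N$ the expected regret of the Greedy Reduction with base algorithm $\mathbb A$ and budget sequence $\{B(t)\}_{t\ge1}$ satisfies $$\mathbb E[\mathrm{Reg}(T)]\le \alpha T^{\beta}+C+\sum_{t=1}^{T}\left(\frac{\alpha}{B(t)^{1-\beta}}+\frac{C}{B(t)}\right).$$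
   Context: Decision-making model. At each round $t$ a context $u_t$ is revealed, the agent selects a policy $\pi_t\in\Pi(u_t)$ (possibly depending on $u_t$, past observations and internal randomness), and the environment generates environment feedback $Z_t$ and reward feedback $R_t$ from fixed distributions conditioned on $(u_t,\pi_t)$, independently of other rounds given $(u_t,\pi_t)$. There is a reward function $f$, and $$\mathrm{Reg}(T)=\sum_{t=1}^T\Big(\max_{\pi\in\Pi(u_t)}\mathbb E[f(R_t)\mid u_t,\pi]-\mathbb E[f(R_t)\mid u_t,\pi_t]\Big).$$ In the unbudgeted problem $Z_t$ and $R_t$ are always observed. In the budgeted problem $Z_t$ is always observed, and the agent chooses $q_t\in\{0,1\}$; $R_t$ is observed only if $q_t=1$. With unit costs, $q_t=1$ is allowed only if the number of earlier queries $\sum_{k<t}q_k$ is at most $B(t)-1$. For the base algorithm $\mathbb A$, $\mathbb A_j(u)$ denotes the policy it outputs at its $j$-th iteration when the input context is $u$ (based on the feedback of its first $j-1$ iterations and internal randomness). ''Anytime'' means the algorithm does not depend on the horizon. Greedy Reduction. Start with $l=0$. For $t=1,2,\dots$: observe $u_t\sim\mathcal P_u$ and $B(t)$. If $B(t)\ge \sum_{k<t}q_k+1$, set $l\leftarrow l+1$, act with $\pi_t=\mathbb A_l(u_t)$ and $q_t=1$, observe $Z_t,R_t$ and pass them to $\mathbb A$ as the feedback of its $l$-th iteration. Otherwise, sample $j$ uniformly from $\{1,\dots,l\}$, act with $\pi_t=\mathbb A_j(u_t)$ and $q_t=0$, and discard $Z_t$. *)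

(* Defs.v *)
From HB Require Import structures.
From mathcomp Require Import all_boot all_order all_algebra.
From mathcomp Require Import all_classical all_reals all_analysis.

Set Implicit Arguments.
Unset Strict Implicit.
Unset Printing Implicit Defensive.

Import Order.TTheory GRing.Theory Num.Theory.
Local Open Scope classical_set_scope.
Local Open Scope ring_scope.

(* k is a regular conditional distribution of Y given X. *)
Definition cond_law (R : realType) d dX dY (Omega : measurableType d)
    (TX : measurableType dX) (TY : measurableType dY)
    (Pr : probability Omega R) (X : Omega -> TX) (Y : Omega -> TY)
    (k : TX -> set TY -> \bar R) : Prop :=
  forall A S, measurable A -> measurable S ->
    Pr (X @^-1` A `&` Y @^-1` S) = (\int[Pr]_(w in X @^-1` A) k (X w) S)%E.

(* The uniform distribution on {1, ..., l}. *)
Definition uniform_index (R : realType) (l : nat) (S : set nat) : \bar R :=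
  (\sum_(1 <= i < l.+1) (l%:R^-1)%:E * \d_i S)%E.

(* Rounds and iterations are numbered from 1; a process indexed by nat is only
   constrained, and only used, at positive indices. *)
Section model.
Context {R : realType} {dU dP dZ dY dW : measure_display}.
Context {U : measurableType dU} {Pol : measurableType dP}.
Context {Z : measurableType dZ} {Y : measurableType dY}.
Context {W : measurableType dW}.

(* U: contexts, Pol: policies, Z: environment feedback, Y: reward feedback. *)
Record problem := Problem {
  context_law : probability U R;
  policies : U -> set Pol;
  feedback : R.-pker (U * Pol) ~> (Z * Y)%type;
  reward : Y -> R }.

Definition mean_reward (M : problem) (u : U) (p : Pol) : R :=
  \int[feedback M (u, p)]_x reward M x.2.

(* Under [well_posed] the supremum is a maximum. *)
Definition best_reward (M : problem) (u : U) : R :=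
  sup [set mean_reward M u p | p in policies M u].

Record well_posed (M : problem) : Prop := WellPosed {
  measurable_reward : measurable_fun setT (reward M);
  integrable_reward : forall u p, policies M u p ->
    (feedback M (u, p)).-integrable setT (fun x => (reward M x.2)%:E);
  max_reward_attained : forall u, exists2 p, policies M u p &
    forall p', policies M u p' -> mean_reward M u p' <= mean_reward M u p;
  measurable_best_reward : measurable_fun setT (best_reward M) }.

(* What an algorithm sees of one of its iterations, once completed: input
   context, selected policy, environment and reward feedback. *)
Definition observation : Type := (U * Pol * Z * Y)%type.

(* [select A s h u] is the policy for input context [u] at iteration
   [(size h).+1], when the internal randomness is [s] and [h] lists the
   observations of the earlier iterations.  No horizon is available to it. *)
Record algorithm (M : problem) := Algorithm {
  seed_law : probability W R;
  select : W -> seq observation -> U -> Pol;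
  select_measurable : forall n, measurable_fun setT
    (fun x : W * n.-tuple observation * U => select x.1.1 x.1.2 x.2);
  select_policies : forall s h u, policies M u (select s h u) }.

Record process (Omega : Type) := Process {
  seed : Omega -> W;
  ctx : nat -> Omega -> U;
  pol : nat -> Omega -> Pol;
  env : nat -> Omega -> Z;
  rew : nat -> Omega -> Y }.

Definition obs Omega (X : process Omega) (t : nat) (w : Omega) : observation :=
  (ctx X t w, pol X t w, env X t w, rew X t w).

Definition regret (M : problem) Omega (X : process Omega) (T : nat)
    (w : Omega) : R :=
  \sum_(1 <= t < T.+1)
    (best_reward M (ctx X t w) - mean_reward M (ctx X t w) (pol X t w)).

Definition random_elements d (Omega : measurableType d) (X : process Omega)
    (T : nat) : Prop :=
  measurable_fun setT (seed X) /\
  forall t, (1 <= t <= T)%N ->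
    [/\ measurable_fun setT (ctx X t), measurable_fun setT (env X t)
      & measurable_fun setT (rew X t)].

Definition past Omega (X : process Omega) (t : nat) (w : Omega) :
    t.-1.-tuple observation :=
  [tuple obs X i.+1 w | i < t.-1].

(* X is the interaction of A with the unbudgeted problem during T rounds.
   The contexts are i.i.d. because each has law [context_law M] conditionally
   on everything that precedes it. *)
Record unbudgeted_run (M : problem) (A : algorithm M) d
    (Omega : measurableType d) (Pr : probability Omega R)
    (X : process Omega) (T : nat) : Prop := UnbudgetedRun {
  unbudgeted_measurable : random_elements X T;
  unbudgeted_seed : forall S, measurable S ->
    Pr (seed X @^-1` S) = seed_law A S;
  unbudgeted_context : forall t, (1 <= t <= T)%N ->
    cond_law Pr (fun w => (seed X w, past X t w)) (ctx X t)
      (fun _ => context_law M);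
  unbudgeted_policy : forall t, (1 <= t <= T)%N -> forall w,
    pol X t w = select A (seed X w) (past X t w) (ctx X t w);
  unbudgeted_feedback : forall t, (1 <= t <= T)%N ->
    cond_law Pr (fun w => (seed X w, past X t w, ctx X t w, pol X t w))
      (fun w => (env X t w, rew X t w))
      (fun x => feedback M (x.1.2, x.2)) }.

(* The number of queries made by the greedy reduction in rounds 1, ..., n. *)
Fixpoint num_queries (B : nat -> nat) (n : nat) : nat :=
  if n is m.+1 then
    (num_queries B m + (num_queries B m + 1 <= B n))%N
  else 0%N.

Definition query (B : nat -> nat) (t : nat) : bool :=
  (num_queries B t.-1 + 1 <= B t)%N.

(* What has been passed to the base algorithm before round t. *)
Definition queried_past (B : nat -> nat) Omega (X : process Omega) (t : nat)
    (w : Omega) : seq observation :=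
  [seq obs X s w | s <- iota 1 t.-1 & query B s].

(* The policy A_j(u_t), where j is a current or an earlier iteration: its
   input is the stored feedback of the first j - 1 iterations. *)
Definition iteration_policy (M : problem) (A : algorithm M) (B : nat -> nat)
    Omega (X : process Omega) (t j : nat) (w : Omega) : Pol :=
  select A (seed X w) (take j.-1 (queried_past B X t w)) (ctx X t w).

Definition full_past Omega (X : process Omega) (idx : nat -> Omega -> nat)
    (t : nat) (w : Omega) : t.-1.-tuple (observation * nat)%type :=
  [tuple (obs X i.+1 w, idx i.+1 w) | i < t.-1].

(* X is the interaction of the greedy reduction of A with the budgeted problem
   during T rounds, and [idx t] is the iteration whose policy is used in round
   t.  [env X t] and [rew X t] exist in every round, but A is only ever given
   those of the rounds with a query. *)
Record greedy_run (M : problem) (A : algorithm M) (B : nat -> nat) d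
    (Omega : measurableType d) (Pr : probability Omega R)
    (X : process Omega) (idx : nat -> Omega -> nat) (T : nat) : Prop :=
  GreedyRun {
  greedy_measurable : random_elements X T;
  greedy_measurable_index : forall t, (1 <= t <= T)%N ->
    measurable_fun setT (idx t);
  greedy_seed : forall S, measurable S ->
    Pr (seed X @^-1` S) = seed_law A S;
  greedy_context : forall t, (1 <= t <= T)%N ->
    cond_law Pr (fun w => (seed X w, full_past X idx t w)) (ctx X t)
      (fun _ => context_law M);
  greedy_index_query : forall t, (1 <= t <= T)%N -> query B t ->
    forall w, idx t w = (num_queries B t.-1).+1;
  greedy_index_replay : forall t, (1 <= t <= T)%N -> ~~ query B t ->
    cond_law Pr (fun w => (seed X w, full_past X idx t w, ctx X t w)) (idx t)
      (fun _ => uniform_index R (num_queries B t.-1));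
  greedy_policy : forall t, (1 <= t <= T)%N -> forall w,
    pol X t w = iteration_policy A B X t (idx t w) w;
  greedy_feedback : forall t, (1 <= t <= T)%N ->
    cond_law Pr
      (fun w => (seed X w, full_past X idx t w, idx t w, ctx X t w, pol X t w))
      (fun w => (env X t w, rew X t w))
      (fun x => feedback M (x.1.2, x.2)) }.

End model.

Arguments problem R {dU dP dZ dY} U Pol Z Y.
Arguments algorithm {R dU dP dZ dY dW U Pol Z Y} W M.
Arguments process {dU dP dZ dY dW} U Pol Z Y W Omega.

(* Main.v *)
(* The query rounds of the greedy reduction, taken alone, form a run of the base
   algorithm, so the expected gaps of its first n iterations sum to at most
   alpha n^beta + C.  In a round without query, l iterations are completed, with
   B(t) <= l.  The index is uniform on {1, ..., l} and independent of the past and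
   of the current context, which in turn has the same law as the context of the
   replayed iteration and is also independent of the feedback preceding that
   iteration.  Hence the expected gap of the round is the average of the first l
   gaps, at most alpha / l^(1 - beta) + C / l. *)
Require Import Defs.
From mathcomp Require Import all_boot all_order all_algebra.
From mathcomp Require Import all_classical all_reals all_analysis.
From mathcomp Require Import measurable_realfun.

Import Order.TTheory GRing.Theory Num.Theory.
Local Open Scope classical_set_scope.
Local Open Scope ring_scope.

(** * Conditional laws and independence *)

Section conditional_laws.
Set Implicit Arguments.
Unset Strict Implicit.
Local Open Scope ereal_scope.
Context {R : realType} {d dX dY : measure_display} {Omega : measurableType d}.
Context {TX : measurableType dX} {TY : measurableType dY}.
Variable Pr : probability Omega R.

(** Coarsening of the conditioning variable: events of [V'] are events of [V], and the kernel
    depends on [V] only through [V']. This passes from the full past of the greedy run to the part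
    that the base algorithm sees. *)
Lemma cond_law_comp d' (TX' : measurableType d') (V : Omega -> TX)
    (V' : Omega -> TX') (Yv : Omega -> TY) (phi : TX -> TX')
    (k : TX -> set TY -> \bar R) (k' : TX' -> set TY -> \bar R) :
  cond_law Pr V Yv k -> measurable_fun setT phi ->
  (forall w, V' w = phi (V w)) -> (forall w, k (V w) = k' (V' w)) ->
  cond_law Pr V' Yv k'.
Proof.
move=> VY mphi V'E kE A S mA mS.
have -> : V' @^-1` A = V @^-1` (phi @^-1` A).
  by apply/funext => w; rewrite /preimage /= V'E.
rewrite VY//; last by rewrite -[X in measurable X]setTI; exact: mphi.
by apply: eq_integral => w _; rewrite kE.
Qed.

Lemma cond_law_cst (V : Omega -> TX) (Yv : Omega -> TY) (m : set TY -> \bar R) :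
  measurable_fun setT V -> cond_law Pr V Yv (fun=> m) ->
  forall A S, measurable A -> measurable S ->
    Pr (V @^-1` A `&` Yv @^-1` S) = m S * Pr (V @^-1` A).
Proof.
move=> mV VY A S mA mS; rewrite VY// integral_cst//.
by rewrite -[X in measurable X]setTI; exact: mV.
Qed.

(* Both pairs have the product law, with the law of V as first marginal. *)
Lemma eq_integral_cond_law (m : probability TY R) (V : Omega -> TX)
    (Y1 Y2 : Omega -> TY) (f : TX * TY -> \bar R) :
  measurable_fun setT V -> measurable_fun setT Y1 -> measurable_fun setT Y2 ->
  cond_law Pr V Y1 (fun=> m) -> cond_law Pr V Y2 (fun=> m) ->
  measurable_fun setT f -> (forall x, 0 <= f x) ->
  \int[Pr]_w f (V w, Y1 w) = \int[Pr]_w f (V w, Y2 w).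
Proof.
move=> mV.
suff H Yv : measurable_fun setT Yv -> cond_law Pr V Yv (fun=> m) ->
    measurable_fun setT f -> (forall x, 0 <= f x) ->
    \int[Pr]_w f (V w, Yv w) =
    \int[distribution Pr (mfun_Sub (mem_set mV)) \x m]_x f x.
  by move=> mY1 mY2 V1 V2 mf f0; rewrite !H.
move=> mY VY mf f0.
have mVY : measurable_fun setT (fun w => (V w, Yv w)).
  exact: measurable_fun_pair.
rewrite -(ge0_integral_distribution (mfun_Sub (mem_set mVY)))//.
apply: eq_measure_integral => A mA _; apply/esym.
apply: product_measure_unique => // A1 A2 mA1 mA2.
rewrite /= /distribution /pushforward /=.
transitivity (Pr (V @^-1` A1 `&` Yv @^-1` A2)); first by [].
by rewrite (cond_law_cst mV VY)// muleC.
Qed.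

Lemma integral_cond_law_setI (V : Omega -> TX) (Yv : Omega -> TY)
    (m : set TY -> \bar R) (f : TX -> \bar R) S (c : R) :
  measurable_fun setT V -> measurable_fun setT Yv ->
  cond_law Pr V Yv (fun=> m) -> measurable S -> m S = c%:E -> (0 <= c)%R ->
  measurable_fun setT f -> (forall x, 0 <= f x) ->
  \int[Pr]_(w in Yv @^-1` S) f (V w) = c%:E * \int[Pr]_w f (V w).
Proof.
move=> mV mY VY mS mSc c0 mf f0.
have mYS : measurable (Yv @^-1` S).
  by rewrite -[X in measurable X]setTI; exact: mY.
pose V' : {mfun Omega >-> TX} := mfun_Sub (mem_set mV).
pose c' : {nonneg R} := NngNum c0.
(* By independence, the push-forward by [V] of [Pr] restricted to the event is [c] times the law of
   [V]. *)
transitivity (\int[pushforward (mrestr Pr mYS) V']_x f x); last first.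
  rewrite (eq_measure_integral (mscale c' (distribution Pr V'))); last first.
    move=> A mA _; rewrite /pushforward /mrestr /mscale /=.
    transitivity (m S * Pr (V @^-1` A)); first exact: cond_law_cst.
    by rewrite mSc.
  by rewrite ge0_integral_mscale// ge0_integral_distribution.
rewrite ge0_integral_pushforward//= preimage_setT.
(* The restricted measure does not charge the complement of the event, and agrees with [Pr] inside
   it. *)
apply/esym; rewrite (ge0_negligible_integral (N := ~` (Yv @^-1` S)))//.
- rewrite setTD setCK; apply: eq_measure_integral => A mA AS.
  by rewrite /= /mrestr setIidl.
- exact: measurableC.
- exact: measurableT_comp.
- by rewrite /= /mrestr setICl measure0.
Qed.
End conditional_laws.

(** * Combinatorics of the query rounds *)

Lemma leq_pred_range {t n : nat} : (0 < t <= n)%N -> (t.-1 <= n)%N.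
Proof. by move=> /andP[_]; apply: leq_trans; exact: leq_pred. Qed.

Section query_times.
Set Implicit Arguments.
Unset Strict Implicit.
Variable B : nat -> nat.

(** Same filter as in [queried_past], which is thus the image of [query_times t.-1] under the
    observations. *)
Definition query_times (n : nat) : seq nat := [seq s <- iota 1 n | query B s].

Lemma query_timesS n : query_times n.+1 =
  if query B n.+1 then rcons (query_times n) n.+1 else query_times n.
Proof.
rewrite /query_times -[in LHS](addn1 n) iotaD filter_cat /= add1n.
by case: ifP => _; rewrite ?cats1 ?cats0.
Qed.

Lemma num_queriesS n : num_queries B n.+1 = (num_queries B n + query B n.+1)%N.
Proof. by []. Qed.

Lemma size_query_times n : size (query_times n) = num_queries B n.
Proof.
elim: n => [//|n IHn]; rewrite query_timesS num_queriesS.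
by case: query; rewrite ?size_rcons IHn ?addn1 ?addn0.
Qed.

Lemma query_times_cat m n : (m <= n)%N ->
  exists s, query_times n = query_times m ++ s.
Proof.
move=> /subnKC <-; rewrite /query_times iotaD filter_cat.
by exists [seq s <- iota (1 + m) (n - m) | query B s].
Qed.

Lemma num_queries_mono m n : (m <= n)%N ->
  (num_queries B m <= num_queries B n)%N.
Proof.
move=> /query_times_cat[s]; rewrite -!size_query_times => ->.
by rewrite size_cat leq_addr.
Qed.

Lemma num_queries_le n : (num_queries B n <= n)%N.
Proof.
rewrite -size_query_times -[leqRHS](size_iota 1) size_filter.
exact: count_size.
Qed.

(* The round of the j-th query; junk unless 1 <= j <= num_queries B T. *)
Definition query_time (T j : nat) : nat := nth 0%N (query_times T) j.-1.

(** The list for [n] is a prefix of the list for [T], so the single enumeration [query_time T]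
    serves all earlier rounds. *)
Lemma take_query_times T n k : (n <= T)%N -> (k <= num_queries B n)%N ->
  take k (query_times n) = [seq query_time T i | i <- iota 1 k].
Proof.
move=> nT; have [s Es] := query_times_cat nT; rewrite -size_query_times => kn.
apply: (@eq_from_nth _ 0%N); first by rewrite size_takel// size_map size_iota.
move=> i; rewrite size_takel// => ik.
rewrite nth_take// (nth_map 0%N) ?size_iota// nth_iota// /query_time Es.
by rewrite nth_cat /= (leq_trans ik kn).
Qed.

Lemma query_time_mem T n j : (n <= T)%N -> (0 < j <= num_queries B n)%N ->
  query_time T j \in query_times n.
Proof.
move=> nT /andP[j0 jn].
rewrite -[query_times n](@take_size nat) size_query_times.
rewrite (take_query_times nT)//; apply: map_f.
by rewrite mem_iota j0 add1n ltnS.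
Qed.

(** The list up to [t] ends with [t], at 0-based position [num_queries B t.-1], and is a prefix of
    the list for [T]. *)
Lemma query_time_query T t : (0 < t <= T)%N -> query B t ->
  query_time T (num_queries B t.-1).+1 = t.
Proof.
case: t => [//|t] /= tT qt; rewrite /query_time /=.
have [s ->] := query_times_cat tT; rewrite query_timesS qt.
by rewrite nth_cat size_rcons size_query_times leqnn nth_rcons
  size_query_times ltnn eqxx.
Qed.

(** The counter starts at 0 and grows by at most one per round, so it cannot skip [j]: some query
    round is preceded by exactly [j.-1] queries. *)
Lemma query_timeP T j : (0 < j <= num_queries B T)%N ->
  [/\ (0 < query_time T j <= T)%N, query B (query_time T j)
    & num_queries B (query_time T j).-1 = j.-1].
Proof.
move=> /andP[j0 jT].
suff [t [tT qt Et]] : exists t, [/\ (0 < t <= T)%N, query B t &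
    num_queries B t.-1 = j.-1].
  by have := query_time_query tT qt; rewrite Et prednK// => ->.
elim: T jT => [|T IHT]; first by case: j j0.
have [jT _|Tj] := leqP j (num_queries B T).
  have [t [/andP[t0 tT] qt Et]] := IHT jT.
  by exists t; split=> //; rewrite t0 leqW.
rewrite num_queriesS; case qT: query => jT; last first.
  by move: jT; rewrite addn0 leqNgt Tj.
exists T.+1; split=> //=.
by apply/eqP; rewrite eqn_leq -ltnS prednK// Tj -ltnS prednK// -addn1.
Qed.
End query_times.

(** * Expected regret as a sum of expected gaps *)

Section regret_of_runs.
Set Implicit Arguments.
Unset Strict Implicit.
Context {R : realType} {dU dP dZ dY dW : measure_display}.
Context {U : measurableType dU} {Pol : measurableType dP}.
Context {Z : measurableType dZ} {Y : measurableType dY} {W : measurableType dW}.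
Variables (M : problem R U Pol Z Y) (HM : well_posed M) (A : algorithm W M).

Definition reward_gap (x : U * Pol) : R :=
  best_reward M x.1 - mean_reward M x.1 x.2.

(** The attained maximum bounds the set of mean rewards, so that its [sup] is a genuine upper
    bound. *)
Lemma reward_gap_ge0 u p : policies M u p -> 0 <= reward_gap (u, p).
Proof.
move=> up; rewrite subr_ge0 /=; have [p0 up0 p0_max] := max_reward_attained HM u.
apply: ub_le_sup; last by exists p.
by exists (mean_reward M u p0) => _ [p' up' <-]; exact: p0_max.
Qed.

Lemma measurable_reward_gap : measurable_fun setT reward_gap.
Proof.
have mreward : measurable_fun setT (fun x : Z * Y => (reward M x.2)%:E).
  apply/measurable_EFinP; apply: measurableT_comp => //.
  exact: measurable_reward HM.
apply: measurable_funB.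
  apply: measurableT_comp => //; exact: measurable_best_reward HM.
rewrite (_ : (fun x => _) = fun x : U * Pol =>
    fine (\int[feedback M x]_y (reward M y.2)%:E)); last first.
  by apply/funext => -[u p].
apply: (measurableT_comp (fine_measurable measurableT)).
(* Positive and negative parts are integrated separately, each integral being measurable in the
   argument of the kernel. *)
under eq_fun do rewrite integralE.
by apply: emeasurable_funB; apply: measurable_fun_integral_kernel => //;
  [exact: measurable_kernel | exact: measurable_funepos
  | exact: measurable_kernel | exact: measurable_funeneg].
Qed.

Context {d : measure_display} {Omega : measurableType d}.
Variable Pr : probability Omega R.

(** Extended-real valued: gaps are nonnegative but not assumed integrable. *)
Definition mean_gap (X : process U Pol Z Y W Omega) (t : nat) : \bar R :=
  (\int[Pr]_w (reward_gap (ctx X t w, pol X t w))%:E)%E.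

Lemma expectation_regret (X : process U Pol Z Y W Omega) T :
  (forall t, (0 < t <= T)%N -> [/\ measurable_fun setT (ctx X t),
    measurable_fun setT (pol X t) &
    forall w, policies M (ctx X t w) (pol X t w)]) ->
  'E_Pr[regret M X T]%E = (\sum_(1 <= t < T.+1) mean_gap X t)%E.
Proof.
move=> HX; rewrite unlock.
transitivity (\int[Pr]_w
    \sum_(i < T) (reward_gap (ctx X i.+1 w, pol X i.+1 w))%:E)%E.
  by apply: eq_integral => w _; rewrite sumEFin /regret big_add1 big_mkord.
rewrite ge0_integral_sum//; first by rewrite big_add1 big_mkord.
  move=> i; have [|mctx mpol _] := HX i.+1; first by rewrite /= ltn_ord.
  apply/measurable_EFinP.
  apply: (measurableT_comp measurable_reward_gap).
  exact: measurable_fun_pair.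
move=> i w _; have [|_ _ Xpol] := HX i.+1; first by rewrite /= ltn_ord.
by rewrite lee_fin reward_gap_ge0.
Qed.

Lemma measurable_select n (S : Omega -> W) (h : Omega -> n.-tuple observation)
    (u : Omega -> U) :
  measurable_fun setT S -> measurable_fun setT h -> measurable_fun setT u ->
  measurable_fun setT (fun w => select A (S w) (h w) (u w)).
Proof.
move=> mS mh mu.
have mShu : measurable_fun setT (fun w => (S w, h w, u w)).
  by apply: measurable_fun_pair => //; exact: measurable_fun_pair.
have mA : measurable_fun setT
    (fun x : W * n.-tuple observation * U => select A x.1.1 x.1.2 x.2).
  exact: select_measurable.
exact: (measurableT_comp mA mShu).
Qed.

Section unbudgeted.
Variables (X : process U Pol Z Y W Omega) (T : nat).
Hypothesis HX : unbudgeted_run A Pr X T.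

(** Strong induction, since measurability of the policies is not part of a run: each earlier policy
    is [select] applied to its own, shorter past. *)
Lemma measurable_past t : (t.-1 <= T)%N -> measurable_fun setT (past X t).
Proof.
have [mseed mX] := unbudgeted_measurable HX.
have [n] := ubnP t; elim: n t => // n IHn t tn tT.
apply/measurable_fun_tnthP => i.
have it : (i.+1 < t)%N by rewrite -ltn_predRL.
have iT : (0 < i.+1 <= T)%N by rewrite /= (leq_trans (ltn_ord i)).
have [mctx menv mrew] := mX _ iT.
rewrite (_ : _ \o _ = obs X i.+1); last first.
  by apply/funext => w /=; rewrite tnth_mktuple.
do 3 apply: measurable_fun_pair => //.
rewrite (_ : pol X i.+1 = fun w =>
    select A (seed X w) (past X i.+1 w) (ctx X i.+1 w)); last first.
  by apply/funext => w; rewrite (unbudgeted_policy HX).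
by apply: measurable_select => //; apply: IHn;
  [exact: leq_trans it _ | exact: ltnW].
Qed.

Lemma measurable_unbudgeted_pol t : (0 < t <= T)%N ->
  measurable_fun setT (pol X t).
Proof.
move=> tT; have [mseed /(_ _ tT)[mctx _ _]] := unbudgeted_measurable HX.
rewrite (_ : pol X t = fun w => select A (seed X w) (past X t w) (ctx X t w)).
  apply: measurable_select => //; apply: measurable_past.
  exact: leq_pred_range.
by apply/funext => w; rewrite (unbudgeted_policy HX).
Qed.

Lemma expectation_unbudgeted_regret :
  'E_Pr[regret M X T]%E = (\sum_(1 <= t < T.+1) mean_gap X t)%E.
Proof.
apply: expectation_regret => t tT; split.
- by have [_ /(_ _ tT)[]] := unbudgeted_measurable HX.
- exact: measurable_unbudgeted_pol.
- by move=> w; rewrite (unbudgeted_policy HX)//; exact: select_policies.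
Qed.

End unbudgeted.

End regret_of_runs.

(** * The base run inside the greedy run, and the replay rounds *)

Section greedy.
Set Implicit Arguments.
Unset Strict Implicit.
Context {R : realType} {dU dP dZ dY dW d : measure_display}.
Context {U : measurableType dU} {Pol : measurableType dP}.
Context {Z : measurableType dZ} {Y : measurableType dY} {W : measurableType dW}.
Context {Omega : measurableType d}.
Variables (M : problem R U Pol Z Y) (HM : well_posed M) (A : algorithm W M).
Variables (B : nat -> nat) (Pr : probability Omega R).
Variables (X : process U Pol Z Y W Omega) (idx : nat -> Omega -> nat) (T : nat).
Hypothesis HX : greedy_run A B Pr X idx T.

(** Time change on the same probability space, with the same seed. Iterations beyond
    [num_queries B T] are junk (round 0). *)
Definition query_process : process U Pol Z Y W Omega :=
  Process (seed X) (fun j => ctx X (query_time B T j))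
    (fun j => pol X (query_time B T j)) (fun j => env X (query_time B T j))
    (fun j => rew X (query_time B T j)).

Local Notation Q := query_process.

(** The bound on [j.-1] allows every completed iteration and also the next one, whose input is the
    whole stored feedback. *)
Lemma take_queried_past t j w : (t.-1 <= T)%N ->
  (j.-1 <= num_queries B t.-1)%N ->
  take j.-1 (queried_past B X t w) = past Q j w.
Proof.
move=> tT jt; rewrite /queried_past -map_take (take_query_times tT jt) /=.
rewrite -map_comp (iotaDl 1 0) -map_comp -val_enum_ord -map_comp.
by apply: eq_map => i.
Qed.

Lemma iteration_policyE t j w : (t.-1 <= T)%N ->
  (j.-1 <= num_queries B t.-1)%N ->
  iteration_policy A B X t j w = select A (seed X w) (past Q j w) (ctx X t w).
Proof. by move=> tT jt; rewrite /iteration_policy take_queried_past. Qed.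

(** As [B] is fixed in advance, the query rounds are deterministic, and the past of the base run
    consists of fixed coordinates of the full past. This provides the map required by
    [cond_law_comp]. *)
Lemma past_query_process t j : (t.-1 <= T)%N ->
  (j.-1 <= num_queries B t.-1)%N ->
  exists2 phi : t.-1.-tuple (observation * nat) -> j.-1.-tuple observation,
    measurable_fun setT phi & forall w, past Q j w = phi (full_past X idx t w).
Proof.
move=> tT jt.
have time_lt (i : 'I_j.-1) : (0 < query_time B T i.+1 <= t.-1)%N.
  have := @query_time_mem B T t.-1 i.+1 tT.
  rewrite /= (leq_trans (ltn_ord i) jt) mem_filter mem_iota add1n ltnS.
  by move=> /(_ isT)/andP[].
have time_lt' (i : 'I_j.-1) : ((query_time B T i.+1).-1 < t.-1)%N.
  by have /andP[? ?] := time_lt i; rewrite prednK.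
(* Round [s] sits at position [s.-1] of the full past; the first projection forgets the index. *)
exists (fun x => [tuple (tnth x (Ordinal (time_lt' i))).1 | i < j.-1]).
  apply/measurable_fun_tnthP => i.
  pose k := Ordinal (time_lt' i).
  rewrite (_ : _ \o _ = fst \o (fun x => tnth x k)); last first.
    by apply/funext => x /=; rewrite tnth_mktuple.
  by apply: measurableT_comp => //; exact: measurable_tnth.
move=> w; apply: eq_from_tnth => i; rewrite !tnth_mktuple /=.
by have /andP[? _] := time_lt i; rewrite prednK.
Qed.

Lemma query_process_unbudgeted n : (n <= num_queries B T)%N ->
  unbudgeted_run A Pr Q n.
Proof.
move=> nT.
have H t : (0 < t <= n)%N -> [/\ (0 < query_time B T t <= T)%N,
    query B (query_time B T t) & num_queries B (query_time B T t).-1 = t.-1].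
  move=> /andP[t0 tn]; apply: query_timeP.
  by rewrite t0 (leq_trans tn).
have [mseed mX] := greedy_measurable HX.
split.
- by split=> // t /H[tT _ _]; exact: mX.
- exact: greedy_seed HX.
- move=> t /H[tT _ Et].
  have [|phi mphi phiE] := @past_query_process _ t (leq_pred_range tT).
    by rewrite Et.
  apply: (cond_law_comp (phi := fun x => (x.1, phi x.2))
    (greedy_context HX tT)) => //.
    apply: measurable_fun_pair => //; exact: measurableT_comp.
  by move=> w /=; rewrite phiE.
- move=> t tn w; have [tT qt Et] := H _ tn.
  (* The round of the [t]-th query is preceded by [t.-1] queries, so its index is [t]. *)
  rewrite /= (greedy_policy HX tT) (greedy_index_query HX tT qt) Et.
  rewrite prednK; last first.
    by case/andP: tn.
  by rewrite iteration_policyE// ?Et// leq_pred_range.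
- move=> t /H[tT _ Et].
  have [|phi mphi phiE] := @past_query_process _ t (leq_pred_range tT).
    by rewrite Et.
  apply: (cond_law_comp (phi := fun x => (x.1.1.1.1, phi x.1.1.1.2, x.1.2, x.2))
    (greedy_feedback HX tT)) => //.
    apply: measurable_fun_pair => //.
    apply: measurable_fun_pair; last exact: measurableT_comp.
    apply: measurable_fun_pair; first by do 3 apply: measurableT_comp => //.
    by do 4 apply: measurableT_comp => //.
  by move=> w /=; rewrite phiE.
Qed.

Lemma le_num_queries_pred t : (0 < t <= T)%N ->
  (num_queries B t.-1 <= num_queries B T)%N.
Proof.
by move=> /leq_pred_range; exact: num_queries_mono.
Qed.

Lemma measurable_past_query_process j :
  (j.-1 <= num_queries B T)%N -> measurable_fun setT (past Q j).
Proof. exact: (measurable_past (query_process_unbudgeted (leqnn _))). Qed.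

Lemma measurable_iteration_policy t j : (0 < t <= T)%N ->
  measurable_fun setT (iteration_policy A B X t j).
Proof.
move=> tT; have [mseed /(_ _ tT)[mctx _ _]] := greedy_measurable HX.
have tT' := leq_pred_range tT.
(* [take] saturates at the length of the stored feedback, so an arbitrary [j] reduces to a prefix
   that is a past of the base run. *)
pose k := minn j.-1 (num_queries B t.-1).
rewrite (_ : iteration_policy A B X t j = iteration_policy A B X t k.+1).
  rewrite (_ : iteration_policy A B X t k.+1 = fun w =>
      select A (seed X w) (past Q k.+1 w) (ctx X t w)); last first.
    by apply/funext => w; rewrite iteration_policyE//= geq_minr.
  apply: measurable_select => //; apply: measurable_past_query_process => /=.
  by rewrite (leq_trans (geq_minr _ _))// le_num_queries_pred.
apply/funext => w; rewrite /iteration_policy /= take_min; congr select.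
by rewrite (@take_oversize _ (num_queries B _))// size_map size_query_times.
Qed.

(** The index has countably many values, and on each of its level sets the policy is that of a fixed
    iteration. *)
Lemma measurable_greedy_pol t : (0 < t <= T)%N -> measurable_fun setT (pol X t).
Proof.
move=> tT _ S mS; rewrite setTI.
rewrite (_ : pol X t @^-1` S = \bigcup_j
    (idx t @^-1` [set j] `&` iteration_policy A B X t j @^-1` S)).
  apply: bigcup_measurable => j _; apply: measurableI.
    rewrite -[X in measurable X]setTI.
    exact: (greedy_measurable_index HX tT).
  rewrite -[X in measurable X]setTI.
  exact: measurable_iteration_policy.
apply/seteqP; split=> w; rewrite /= (greedy_policy HX tT).
  by exists (idx t w).
by move=> [j _ [/= -> ]].
Qed.

Lemma policies_greedy_pol t w : (0 < t <= T)%N ->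
  policies M (ctx X t w) (pol X t w).
Proof.
by move=> tT; rewrite (greedy_policy HX tT); exact: select_policies.
Qed.

Lemma mean_gap_query_process_ge0 j : (0 < j <= num_queries B T)%N ->
  (0 <= mean_gap M Pr Q j)%E.
Proof.
move=> jT; apply: integral_ge0 => w _; rewrite lee_fin.
apply: (reward_gap_ge0 HM).
rewrite (unbudgeted_policy (query_process_unbudgeted (leqnn _)) jT).
exact: select_policies.
Qed.

Lemma uniform_index1 l j : (0 < j <= l)%N ->
  uniform_index R l [set j] = (l%:R^-1)%:E.
Proof.
move=> /andP[j0 jl]; rewrite /uniform_index (bigD1_seq j) ?iota_uniq//=; last first.
  by rewrite mem_index_iota j0.
rewrite diracE mem_set// mule1 big1 ?adde0// => i ij.
rewrite diracE memNset ?mule0//= => ji.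
by rewrite ji eqxx in ij.
Qed.

Lemma uniform_index_out l :
  uniform_index R l [set j | ~~ (0 < j <= l)%N] = 0%E.
Proof.
rewrite /uniform_index big1_seq// => i; rewrite mem_index_iota => /= il.
by rewrite diracE memNset ?mule0//= -ltnS il.
Qed.

Lemma mean_gap_replay t (l := num_queries B t.-1) :
  (0 < t <= T)%N -> ~~ query B t ->
  mean_gap M Pr X t =
  ((l%:R^-1)%:E * \sum_(1 <= j < l.+1) mean_gap M Pr Q j)%E.
Proof.
move=> tT qt; have lT := le_num_queries_pred tT; rewrite -/l in lT.
have [mseed /(_ _ tT)[mctx _ _]] := greedy_measurable HX.
have midx := greedy_measurable_index HX tT.
have idx_law := greedy_index_replay HX tT qt; rewrite -/l in idx_law.
have tT' := leq_pred_range tT.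
pose g w := (reward_gap M (ctx X t w, pol X t w))%:E.
have mg : measurable_fun setT g.
  apply/measurable_EFinP.
  apply: (measurableT_comp (measurable_reward_gap HM)).
  by apply: measurable_fun_pair => //; exact: measurable_greedy_pol.
have g0 w : (0 <= g w)%E.
  by rewrite lee_fin reward_gap_ge0//; exact: policies_greedy_pol.
have midx_pre S : measurable (idx t @^-1` S).
  by rewrite -[X in measurable X]setTI; exact: midx.
(* The index lies in {1, ..., l} only almost surely; the other values are removed as a null event
   before splitting along the index. *)
pose N := [set j | ~~ (0 < j <= l)%N].
have idxN : Pr (idx t @^-1` N) = 0%E.
  have := idx_law setT N measurableT.
  rewrite preimage_setT setTI => -> //.
  by under eq_integral do rewrite uniform_index_out; rewrite integral0.
have D_E : setT `\` idx t @^-1` N =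
    \big[setU/set0]_(j <- index_iota 1 l.+1) (idx t @^-1` [set j]).
  rewrite -bigcup_seq; apply/seteqP; split=> w /=.
    move=> [_ /negP/negPn idxl]; exists (idx t w) => //=.
    by rewrite mem_index_iota ltnS.
  move=> [j /=]; rewrite mem_index_iota ltnS => jl idxj; split=> // /negP[].
  by rewrite idxj.
rewrite /mean_gap (ge0_negligible_integral (midx_pre N))//; last first.
  by move=> w _; exact: g0.
rewrite D_E ge0_integral_bigsetU//=; last 4 first.
- exact: iota_uniq.
- exact: trivIset_preimage1.
- exact: measurable_funS mg.
- by move=> w _; exact: g0.
rewrite [in RHS]big_seq ge0_sume_distrr; last first.
  move=> j; rewrite mem_index_iota ltnS => /andP[j0 jl].
  by apply: mean_gap_query_process_ge0; rewrite j0 (leq_trans jl).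
rewrite -big_seq.
apply: eq_big_seq => j; rewrite mem_index_iota ltnS => jl.
have jl' := leq_pred_range jl.
have [phi mphi phiE] := past_query_process tT' jl'.
have mpast : measurable_fun setT (past Q j).
  by apply: measurable_past_query_process; exact: leq_trans jl' lT.
pose f (x : W * j.-1.-tuple observation * U) :=
  (reward_gap M (x.2, select A x.1.1 x.1.2 x.2))%:E.
have mf : measurable_fun setT f.
  apply/measurable_EFinP.
  apply: (measurableT_comp (measurable_reward_gap HM)).
  by apply: measurable_fun_pair => //; exact: select_measurable.
have f0 x : (0 <= f x)%E.
  by rewrite lee_fin reward_gap_ge0//; exact: select_policies.
have mV : measurable_fun setT (fun w => (seed X w, past Q j w)).
  exact: measurable_fun_pair.
have Qrun := query_process_unbudgeted (leqnn _).
have jT : (0 < j <= num_queries B T)%N.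
  by case/andP: jl => -> /=; move=> /leq_trans; exact.
(* Where the index is [j], the gap depends only on the seed, the first [j.-1] query observations and
   the current context; the index is independent of these, which yields the factor 1/l. *)
transitivity (\int[Pr]_(w in idx t @^-1` [set j])
    f (seed X w, past Q j w, ctx X t w))%E.
  apply: eq_integral => w; rewrite inE /= => idxj.
  by rewrite /g (greedy_policy HX tT) idxj iteration_policyE.
transitivity ((l%:R^-1)%:E *
    \int[Pr]_w f (seed X w, past Q j w, ctx X t w))%E.
  apply: (integral_cond_law_setI (V := fun w => (seed X w, past Q j w, ctx X t w))
    (m := uniform_index R l)) => //.
  - exact: measurable_fun_pair.
  - apply: (cond_law_comp (phi := fun x => (x.1.1, phi x.1.2, x.2)) idx_law) => //.
      apply: measurable_fun_pair => //; apply: measurable_fun_pair => //.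
        exact: measurableT_comp.
      by do 2 apply: measurableT_comp => //.
    by move=> w /=; rewrite phiE.
  - exact: uniform_index1.
congr mule.
(* The current context is exchanged for that of the [j]-th query: both have law [context_law M] and
   are independent of the seed and of [past Q j]. *)
transitivity (\int[Pr]_w f (seed X w, past Q j w, ctx Q j w))%E; last first.
  by apply: eq_integral => w _; rewrite /f /= -(unbudgeted_policy Qrun jT).
apply: (eq_integral_cond_law (V := fun w => (seed X w, past Q j w))
  (m := context_law M)) => //.
- by have [_ /(_ _ jT)[]] := unbudgeted_measurable Qrun.
- apply: (cond_law_comp (phi := fun x => (x.1, phi x.2))
    (greedy_context HX tT)) => //.
    by apply: measurable_fun_pair => //; exact: measurableT_comp.
  by move=> w /=; rewrite phiE.
- exact: (unbudgeted_context Qrun jT).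
Qed.


End greedy.

(** * Summation of the regret bound *)

(** The left side equals alpha / l^(1 - beta) + C / l, which is nonincreasing in [l] because beta <=
    1. *)
Lemma inv_powR_average (R : realType) (alpha beta C : R) (b l : nat) :
  0 <= alpha -> 0 <= C -> beta <= 1 -> (0 < b <= l)%N ->
  l%:R^-1 * (alpha * l%:R `^ beta + C) <=
  alpha / b%:R `^ (1 - beta) + C / b%:R :> R.
Proof.
move=> alpha0 C0 beta1 /andP[b0 bl].
have b0' : 0 < b%:R :> R by rewrite ltr0n.
have bl' : b%:R <= l%:R :> R by rewrite ler_nat.
have l0' : 0 < l%:R :> R by exact: lt_le_trans bl'.
have -> : l%:R^-1 * (alpha * l%:R `^ beta + C) =
    alpha / l%:R `^ (1 - beta) + C / l%:R :> R.
  have -> : l%:R `^ (1 - beta) = l%:R / l%:R `^ beta :> R.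
    by rewrite powRB ?(gt_eqF l0') ?implybT// powRr1 ?ler0n.
  by rewrite invf_div mulrDr [_ * C]mulrC mulrCA [_^-1 * _]mulrC.
apply: lerD; apply: ler_wpM2l => //; rewrite lef_pV2 ?posrE// ?powR_gt0//.
by apply: ge0_ler_powR; rewrite ?subr_ge0// ?nnegrE ltW.
Qed.

Theorem theorem1 (R : realType) (dU dP dZ dY dW : measure_display)
  (U : measurableType dU) (Pol : measurableType dP)
  (Z : measurableType dZ) (Y : measurableType dY) (W : measurableType dW)
  (M : problem R U Pol Z Y) (HM : well_posed M)
  (A : algorithm W M) (alpha beta C : R)
  (alpha_ge0 : 0 <= alpha) (C_ge0 : 0 <= C) (beta01 : 0 <= beta <= 1)
  (HA : forall (d : measure_display) (Omega : measurableType d)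
      (Pr : probability Omega R) (X : process U Pol Z Y W Omega) (T : nat),
    unbudgeted_run A Pr X T ->
    ('E_Pr[regret M X T] <= (alpha * T%:R `^ beta + C)%:E)%E)
  (B : nat -> nat) (B1 : (1 <= B 1)%N)
  (B_mono : forall s t : nat, (1 <= s)%N -> (s <= t)%N -> (B s <= B t)%N)
  (d : measure_display) (Omega : measurableType d) (Pr : probability Omega R)
  (X : process U Pol Z Y W Omega) (idx : nat -> Omega -> nat) (T : nat)
  (HX : greedy_run A B Pr X idx T) :
  ('E_Pr[regret M X T] <=
    (alpha * T%:R `^ beta + C
     + \sum_(1 <= t < T.+1)
         (alpha / (B t)%:R `^ (1 - beta) + C / (B t)%:R))%:E)%E.
Proof.
have [beta0 beta1] := andP beta01.
(* The guarantee is needed at every horizon [n], which is where the anytime property enters. *)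
have le_avg n : (n <= num_queries B T)%N ->
    (\sum_(1 <= j < n.+1) mean_gap M Pr (query_process B X T) j <=
     (alpha * n%:R `^ beta + C)%:E)%E.
  move=> nT; have Qrun := query_process_unbudgeted HX nT.
  by rewrite -(expectation_unbudgeted_regret HM Qrun); exact: HA Qrun.
pose extra t : R := alpha / (B t)%:R `^ (1 - beta) + C / (B t)%:R.
have extra0 t : 0 <= extra t.
  by apply: addr_ge0; apply: divr_ge0 => //; exact: powR_ge0.
(* Induction on rounds: a query round is charged to the next base iteration, its nonnegative [extra]
   term being slack; a replay round is charged to its own [extra] term. *)
have prefix m : (m <= T)%N ->
    (\sum_(1 <= t < m.+1) mean_gap M Pr X t <=
     \sum_(1 <= j < (num_queries B m).+1)
        mean_gap M Pr (query_process B X T) j +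
     (\sum_(1 <= t < m.+1) extra t)%:E)%E.
  elim: m => [_|m IHm mT]; first by rewrite !big_geq// adde0.
  rewrite big_nat_recr//= [X in (_ + X%:E)%E]big_nat_recr//= EFinD.
  rewrite -/(query B m.+1).
  have [qm|qm] := boolP (query B m.+1).
    rewrite addn1 [X in (_ <= X + _)%E]big_nat_recr//= addeACA.
    rewrite leeD ?IHm// 1?ltnW//.
    have -> : mean_gap M Pr X m.+1 =
        mean_gap M Pr (query_process B X T) (num_queries B m).+1.
      by rewrite /mean_gap /= (query_time_query (t := m.+1)).
    by rewrite leeDl// lee_fin.
  rewrite addn0 [X in (_ <= X)%E]addeA leeD ?IHm// 1?ltnW//.
  rewrite (mean_gap_replay HM HX)//=.
  apply: (le_trans (lee_wpmul2l _ (le_avg _ (num_queries_mono B (ltnW mT))))).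
    by rewrite lee_fin invr_ge0.
  rewrite -EFinM lee_fin; apply: inv_powR_average => //.
  (* Positivity of the budget comes from [B 1]; the refusal of the query gives
     [B m.+1 <= num_queries B m]. *)
  rewrite (leq_trans B1 (B_mono _ _ _ _))//=.
  by move: qm; rewrite /query /= addn1 -ltnNge ltnS.
rewrite (expectation_regret HM) => [|t tT]; last first.
  split.
  - by have [_ /(_ _ tT)[]] := greedy_measurable HX.
  - exact: (measurable_greedy_pol HX).
  - by move=> w; exact: (policies_greedy_pol HX).
apply: (le_trans (prefix T (leqnn T))).
rewrite EFinD leeD2r//; apply: (le_trans (le_avg _ (leqnn _))).
(* At most [T] queries are made, and the power is nondecreasing since beta >= 0. *)
rewrite lee_fin lerD2r ler_wpM2l// ge0_ler_powR ?nnegrE ?ler0n// ler_nat.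
exact: num_queries_le.
Qed.
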